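(* Let $A,B$ be real $2\times 2$ matrices that are both symmetric (or both skew-symmetric). Then the weak interlacing property, the interlacing property and the strong interlacing property hold for $A,B$.
   Context: All matrices are real and $\otimes$ is the Kronecker product. Let $T\in\mathbb{R}^{n^2\times n^2}$ be the commutation matrix, i.e. $T\operatorname{vec}(X)=\operatorname{vec}(X^\top)$ for all $X\in\mathbb{R}^{n\times n}$, where $\operatorname{vec}$ stacks columns. A vector $x\in\mathbb{R}^{n^2}$ is symmetric if $Tx=x$ and skew-symmetric if $Tx=-x$. For $n\times n$ matrices $A,B$ both symmetric or both skew-symmetric, $C:=A\otimes B+B\otimes A$ is a symmetric matrix commuting with $T$, so it has an orthonormal eigenbasis in which each eigenvector is either symmetric or skew-symmetric. The even eigenvalues of $C$ are its eigenvalues (with multiplicity) on the subspace of symmetric vectors, $\lambda_1\ge\cdots\ge\lambda_s$, $s=n(n+1)/2$; the odd eigenvalues are its eigenvalues (with multiplicity) on the subspace of skew-symmetric vectors, $\beta_1\ge\cdots\ge\beta_t$, $t=n(n-1)/2$. Interlacing property: $\lambda_i\ge\beta_i\ge\lambda_{s-t+i}$ for all $i\in\{1,\dots,t\}$. Weak interlacing property: $\min_{Tu=u}\frac{u^\top(A\otimes B)u}{u^\top u}\le\min_{Tw=-w}\frac{w^\top(A\otimes B)w}{w^\top w}$ and $\max_{Tw=-w}\frac{w^\top(A\otimes B)w}{w^\top w}\le\max_{Tu=u}\frac{u^\top(A\otimes B)u}{u^\top u}$, over nonzero vectors. Strong interlacing property: the $n^2$ eigenvalues of $C$ can be listed in non-increasing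 order, with corresponding orthonormal eigenvectors each symmetric or skew-symmetric, so that whenever the $k$th eigenvalue, $k\in\{2,\dots,n^2-1\}$, is odd (has a skew-symmetric eigenvector in the list), the $(k-1)$th and $(k+1)$th eigenvalues are associated with symmetric eigenvectors. *)

(* Defs.v *)
From mathcomp Require Import all_boot all_order all_algebra.
From mathcomp Require Import classical_sets reals.
From mathcomp Require Export mxtens.

Set Implicit Arguments.
Unset Strict Implicit.
Unset Printing Implicit Defensive.

Import Order.TTheory GRing.Theory Num.Theory.
Local Open Scope classical_set_scope.
Local Open Scope ring_scope.

Section Defs.
Variables (R : realType) (n : nat).
Implicit Types (A B X : 'M[R]_n) (M C : 'M[R]_(n * n)) (x : 'cV[R]_(n * n)).

(* [mxtens_index (j, i) = j * n + i], the indexing used by the Kronecker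
   product [A *t B]: entry (i, j) of X goes to position j * n + i, i.e. the
   columns of X are stacked. *)
Definition vec X : 'cV[R]_(n * n) :=
  \col_k X (mxtens_unindex k).2 (mxtens_unindex k).1.

Definition commutation_mx : 'M[R]_(n * n) :=
  \matrix_(k, l) (mxtens_unindex l ==
                  ((mxtens_unindex k).2, (mxtens_unindex k).1))%:R.

Lemma commutation_mxP X : commutation_mx *m vec X = vec X^T.
Proof.
apply/colP => k; rewrite !mxE.
rewrite (bigD1 (mxtens_index ((mxtens_unindex k).2, (mxtens_unindex k).1))) //=.
rewrite !mxE mxtens_indexK eqxx mul1r big1 ?addr0 // => l lk.
rewrite !mxE -(can_eq (@mxtens_indexK n n)) mxtens_unindexK.
by rewrite (negPf lk) mul0r.
Qed.

Lemma vec_surj x : exists X, vec X = x.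
Proof.
exists (\matrix_(i, j) x (mxtens_index (j, i)) 0); apply/colP => k.
by rewrite !mxE -surjective_pairing mxtens_unindexK.
Qed.

Lemma commutation_mx_unique M :
  (forall X, M *m vec X = vec X^T) -> M = commutation_mx.
Proof.
move=> MP; apply/matrixP => k l.
have [X eX] := vec_surj (delta_mx l 0).
have E (N : 'M[R]_(n * n)) : (N *m vec X) k 0 = N k l.
  by rewrite eX -colE mxE.
by rewrite -!E MP commutation_mxP.
Qed.

Definition symmetric_vec x := commutation_mx *m x = x.
Definition skew_vec x := commutation_mx *m x = - x.

Definition kron_sym A B : 'M[R]_(n * n) := A *t B + B *t A.

(* [eigenspace g a] is a space of row vectors u with u *m g = a *: u, hence the
   transposes: in terms of column vectors these are the dimensions of
   {x | C x = a x, T x = x} and {x | C x = a x, T x = - x}. *)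
Definition even_mult C (a : R) : nat :=
  \rank (eigenspace C^T a :&: eigenspace commutation_mx^T 1)%MS.
Definition odd_mult C (a : R) : nat :=
  \rank (eigenspace C^T a :&: eigenspace commutation_mx^T (-1))%MS.

Definition even_eigenvalues C (lam : ((n * n.+1) %/ 2).-tuple R) : Prop :=
  sorted >=%R lam /\ forall a, count_mem a lam = even_mult C a.
Definition odd_eigenvalues C (beta : ((n * n.-1) %/ 2).-tuple R) : Prop :=
  sorted >=%R beta /\ forall a, count_mem a beta = odd_mult C a.

(* Indices start at 0. *)
Definition interlacing A B : Prop :=
  let s := ((n * n.+1) %/ 2)%N in
  let t := ((n * n.-1) %/ 2)%N in
  exists (lam : s.-tuple R) (beta : t.-tuple R),
    [/\ even_eigenvalues (kron_sym A B) lam,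
        odd_eigenvalues (kron_sym A B) beta &
        forall i : nat, (i < t)%N ->
          beta`_i <= lam`_i /\ lam`_(s - t + i) <= beta`_i].

Definition rayleigh M x : R := (x^T *m M *m x) 0 0 / (x^T *m x) 0 0.

Definition is_min (S : set R) (m : R) : Prop := S m /\ lbound S m.
Definition is_max (S : set R) (m : R) : Prop := S m /\ ubound S m.

Definition sym_rayleigh M : set R :=
  [set rayleigh M u | u in [set u | symmetric_vec u /\ u != 0]].
Definition skew_rayleigh M : set R :=
  [set rayleigh M w | w in [set w | skew_vec w /\ w != 0]].

Definition weak_interlacing A B : Prop :=
  exists minu minw maxu maxw : R,
    [/\ is_min (sym_rayleigh (A *t B)) minu,
        is_min (skew_rayleigh (A *t B)) minw,
        is_max (sym_rayleigh (A *t B)) maxu &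
        is_max (skew_rayleigh (A *t B)) maxw] /\
    (minu <= minw /\ maxw <= maxu).

(* The columns of V are the eigenvectors, in the order of the eigenvalues mu;
   i, k, j are three consecutive positions. *)
Definition strong_interlacing A B : Prop :=
  exists (mu : 'I_(n * n) -> R) (V : 'M[R]_(n * n)),
    [/\ forall i j : 'I_(n * n), (i <= j)%N -> mu j <= mu i,
        V^T *m V = 1%:M,
        forall k, kron_sym A B *m col k V = mu k *: col k V,
        forall k, symmetric_vec (col k V) \/ skew_vec (col k V) &
        forall i k j : 'I_(n * n), k = i.+1 :> nat -> j = k.+1 :> nat ->
          skew_vec (col k V) ->
          symmetric_vec (col i V) /\ symmetric_vec (col j V)].

End Defs.

(* Main.v *)
(** For a symmetric [X], [vec X] is an even vector and the Rayleigh quotient of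
    [A *t B] there is [\tr (X B X A^T) / \tr (X^2)]; on the line of odd vectors,
    spanned by [vec J] with [J] the rotation by a right angle, [A *t B + B *t A]
    has the eigenvalue [\det (A + B) - \det A - \det B].  The even vector given by
    [X = A J - J A], or by [X = 1] if [A] and [J] commute, has the same Rayleigh
    quotient as [vec J].  Hence the odd eigenvalue, which is the only one, lies
    between the extreme even ones. *)

Require Import Defs.
From mathcomp Require Import all_boot all_order all_algebra.
From mathcomp Require Import reals.
From mathcomp Require Import complex perm ring.

Set Implicit Arguments.
Unset Strict Implicit.
Unset Printing Implicit Defensive.

Import Order.TTheory GRing.Theory Num.Theory.
Local Open Scope ring_scope.

(** * Orthogonal diagonalization of real symmetric matrices *)

(** Over [R[i]] the matrix is hermitian, so the spectral theorem applies and its spectral diagonal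
    is real; being an eigenvalue descends along the embedding of [R]. *)
Lemma real_symmetric_eigenvalue (R : rcfType) n (C : 'M[R]_n.+1) :
  C^T = C -> exists a, eigenvalue C a.
Proof.
move=> symC; pose D := map_mx (real_complex R) C.
have hermD : D \is hermsymmx.
  apply: realsym_hermsym.
    apply/is_hermitianmxP; rewrite expr0 scale1r map_mx_id // /D.
    by apply/matrixP => i j; rewrite !mxE -[in RHS]symC mxE.
  by apply/mxOverP => i j; rewrite mxE complex_real.
have /orthomx_spectralP eD := hermitian_normalmx hermD.
have /mxOverP/(_ 0 0)/complex_realP[a ea] := hermitian_spectral_diag_real hermD.
have unitP := spectral_unit D.
exists a; rewrite -(eigenvalue_map (real_complex R)); apply/eigenvalueP.
exists (row 0 (spectralmx D)).
  rewrite -/D [X in _ *m X]eD !mulmxA -row_mul mulmxV // -row_mul mul1mx.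
  rewrite -row_mul; apply/rowP => j; rewrite mul_diag_mx.
  by rewrite [LHS]mxE [RHS]mxE mxE [row _ _ _ _]mxE ea.
apply: contraTneq unitP => P0.
have : row 0 (spectralmx D *m invmx (spectralmx D)) = 0.
  by rewrite row_mul P0 mul0mx.
apply: contra_eqN => /mulmxV->.
by apply/eqP => /rowP/(_ 0)/eqP; rewrite !mxE eqxx oner_eq0.
Qed.

Lemma dot_gt0 (R : realFieldType) n (x : 'cV[R]_n) :
  x != 0 -> 0 < (x^T *m x) 0 0.
Proof.
move=> x0; have [i xi0] : exists i, x i 0 != 0.
  apply/existsP; apply: contraNT x0 => /existsPn x0.
  by apply/eqP/colP => i; rewrite mxE; apply/eqP/negPn.
rewrite mxE (bigD1 i) //= mxE -expr2 ltr_pwDl ?sumr_ge0 //.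
  by rewrite lt_def sqrf_eq0 xi0 sqr_ge0.
by move=> j _; rewrite mxE -expr2 sqr_ge0.
Qed.

Lemma unit_col0_orthogonal (R : realFieldType) n (w : 'cV[R]_n.+1) :
  w^T *m w = 1%:M -> exists2 Q : 'M[R]_n.+1, Q^T *m Q = 1%:M & col 0 Q = w.
Proof.
move=> ww; pose e : 'cV[R]_n.+1 := delta_mx 0 0.
(* The reflection below divides by $|e-w|^2$, so the case [w = e] is settled by the identity. *)
have [->|neq] := eqVneq w e.
  by exists 1%:M; [rewrite trmx1 mulmx1 | rewrite colE mul1mx].
have [h hE] : exists h, h = e - w by exists (e - w).
pose s := (h^T *m h) 0 0.
have hh : h^T *m h = s%:M by apply: mx11_scalar.
have s0 : s != 0 by rewrite gt_eqF // dot_gt0 // hE subr_eq0 eq_sym.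
have ee : e^T *m e = 1%:M.
  by rewrite trmx_delta mul_delta_mx [LHS]mx11_scalar mxE.
have ew : e^T *m w = w^T *m e.
  by rewrite -[RHS]trmxK trmx_mul trmxK [RHS]mx11_scalar mxE -mx11_scalar.
(* As [e] and [w] are unit vectors, $|e-w|^2 = 2(1-w^\top e)$; hence the reflection moves [e] by
   exactly [- h]. *)
have eh : h^T *m e = (s / 2)%:M.
  apply: (@scalerI _ _ 2); rewrite ?pnatr_eq0 //.
  rewrite scale_scalar_mx mulrCA divff ?pnatr_eq0 // mulr1.
  rewrite -hh hE [(_ - _)^T]raddfB /= mulmxBr !mulmxBl ee ww ew.
  by rewrite scaler_nat mulr2n opprB addrA.
(* The Householder reflection exchanging [e] and [w]. *)
pose Q : 'M[R]_n.+1 := 1%:M - (2 / s) *: (h *m h^T).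
have symQ : Q^T = Q.
  by rewrite /Q raddfB /= linearZ /= trmx_mul trmxK trmx1.
exists Q.
  rewrite symQ /Q mulmxBr mulmx1 mulmxBl mul1mx -scalemxAr -scalemxAl.
  rewrite mulmxA -(mulmxA h) hh mul_mx_scalar -scalemxAl !scalerA.
  have -> : 2 / s * (2 / s) * s = 2 / s + 2 / s by field.
  by rewrite scalerDl opprB addrK subrK.
rewrite colE -/e mulmxBl mul1mx -scalemxAl -mulmxA eh mul_mx_scalar scalerA.
by rewrite mulf_div (mulrC 2) divff ?mulf_neq0 ?pnatr_eq0 // scale1r hE subKr.
Qed.

Lemma col_mulmx (R : pzSemiRingType) m n p k (A : 'M[R]_(m, n)) (B : 'M_(n, p)) :
  col k (A *m B) = A *m col k B.
Proof. by rewrite !colE mulmxA. Qed.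

(** [V] is a parameter so that one basis can diagonalize two matrices at once. *)
Definition orthogonal_diagonalization (R : realFieldType) n (C V : 'M[R]_n)
  (d : 'rV[R]_n) := V^T *m V = 1%:M /\ C *m V = V *m diag_mx d.

Section Diag.
Variables (R : realFieldType) (n : nat) (C V : 'M[R]_n) (d : 'rV[R]_n).
Hypothesis hV : orthogonal_diagonalization C V d.

Lemma odiag_mulmxtr : V *m V^T = 1%:M.
Proof. exact: mulmx1C hV.1. Qed.

Lemma odiag_trmx : C^T = C.
Proof.
have eC : C = V *m diag_mx d *m V^T.
  by rewrite -hV.2 -mulmxA odiag_mulmxtr mulmx1.
by rewrite eC !trmx_mul trmxK tr_diag_mx mulmxA.
Qed.

Lemma odiag_col k : C *m col k V = d 0 k *: col k V.
Proof.
by rewrite -col_mulmx hV.2; apply/colP => i; rewrite mul_mx_diag !mxE mulrC.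
Qed.

Lemma odiag_dot (x : 'cV[R]_n) :
  (x^T *m x) 0 0 = \sum_k ((V^T *m x) k 0) ^+ 2.
Proof.
have -> : x^T *m x = (V^T *m x)^T *m (V^T *m x).
  by rewrite trmx_mul trmxK mulmxA -(mulmxA x^T) odiag_mulmxtr mulmx1.
by rewrite mxE; apply: eq_bigr => k _; rewrite mxE.
Qed.

Lemma odiag_form (x : 'cV[R]_n) :
  (x^T *m C *m x) 0 0 = \sum_k d 0 k * ((V^T *m x) k 0) ^+ 2.
Proof.
have -> : x^T *m C *m x = (V^T *m x)^T *m diag_mx d *m (V^T *m x).
  rewrite trmx_mul trmxK -!mulmxA (mulmxA V) -hV.2 -!mulmxA (mulmxA V).
  by rewrite odiag_mulmxtr mul1mx.
rewrite mxE; apply: eq_bigr => k _; rewrite mul_mx_diag mxE [_^T _ _]mxE.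
by rewrite -mulrA mulrCA expr2.
Qed.

Lemma odiag_eigen_coord (u : 'rV[R]_n) a k :
  u *m C^T = a *: u -> d 0 k != a -> (u *m V) 0 k = 0.
Proof.
rewrite odiag_trmx => uC dka.
have /rowP/(_ k)/eqP : u *m V *m diag_mx d = a *: (u *m V).
  by rewrite -mulmxA -hV.2 mulmxA uC scalemxAl.
rewrite mul_mx_diag !mxE mulrC -subr_eq0 -mulrBl mulf_eq0 subr_eq0 (negPf dka).
by move=> /eqP.
Qed.

End Diag.

(** Deflation: in an orthonormal basis starting with [w], the first column is [b] times the first
    unit vector, and symmetry then leaves [b] and a symmetric block. Diagonalizability of the block
    is a hypothesis, so that the lemma serves both the induction on the size and the choice of a
    prescribed first column. *)
Lemma orthogonal_diagonalization_lift (R : realFieldType) n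
    (w : 'cV[R]_n.+1) (b : R) (C : 'M[R]_n.+1) :
    (forall S : 'M[R]_n, S^T = S ->
      exists V d, orthogonal_diagonalization S V d) ->
    C^T = C -> w^T *m w = 1%:M -> C *m w = b *: w ->
  exists V d, [/\ orthogonal_diagonalization C V d, col 0 V = w & d 0 0 = b].
Proof.
move=> IH symC ww Cw; have [Q QQ Q0] := unit_col0_orthogonal ww.
pose M : 'M[R]_(1 + n) := Q^T *m C *m Q.
have symM : M^T = M by rewrite /M !trmx_mul trmxK symC mulmxA.
have M0 : col 0 M = b *: col 0 1%:M.
  by rewrite /M -mulmxA !col_mulmx Q0 Cw -scalemxAr -Q0 -col_mulmx QQ.
have l0 : lshift n 0 = 0 :> 'I_(1 + n) by apply: val_inj.
have eM : M = block_mx b%:M 0 0 (drsubmx M).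
  move: M symM M0 => M symM /colP M0.
  have Mi0 i : M i 0 = b * (i == 0)%:R by have := M0 i; rewrite !mxE.
  have dl : dlsubmx M = 0.
    by apply/matrixP => i j; rewrite ord1 !mxE l0 Mi0 mulr0.
  rewrite -[LHS]submxK dl -[ursubmx M]trmxK trmx_ursub symM dl trmx0.
  congr block_mx; apply/matrixP => i j.
  by rewrite !ord1 !mxE l0 Mi0 mulr1.
have [|U [d [UU Ud]]] := IH (drsubmx M); first by rewrite trmx_drsub symM.
pose W : 'M[R]_(1 + n) := block_mx 1%:M 0 0 U.
have WW : W^T *m W = 1%:M.
  rewrite tr_block_mx mulmx_block !trmx0 !mulmx0 !mul0mx !addr0 add0r.
  by rewrite trmx1 mulmx1 UU -scalar_mx_block.
have W0 : col 0 W = col 0 1%:M.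
  rewrite -l0 (@scalar_mx_block _ 1 n) /W !block_mxEh.
  exact: etrans (colKl _ _ _) (esym (colKl _ _ _)).
exists (Q *m W), (row_mx b%:M d); split.
- split; first by rewrite trmx_mul mulmxA -(mulmxA W^T) QQ mulmx1.
  have -> : C *m (Q *m W) = Q *m (M *m W).
    by rewrite /M !mulmxA (mulmx1C QQ) mul1mx.
  rewrite -[RHS]mulmxA; congr (_ *m _); rewrite eM (diag_mx_row b%:M d).
  rewrite /W mulmx_block; transitivity
    (block_mx 1%:M 0 0 U *m block_mx (diag_mx (b%:M : 'rV_1)) 0 0 (diag_mx d));
    last by [].
  rewrite mulmx_block !mulmx0 !mul0mx !addr0 !add0r Ud mul1mx mulmx1.
  have -> // : diag_mx (b%:M : 'rV_1) = b%:M.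
  by apply/matrixP => i j; rewrite !ord1 !mxE eqxx.
- by rewrite col_mulmx W0 -col_mulmx mulmx1.
- by rewrite -l0 [LHS]row_mxEl mxE.
Qed.

(** Induction on the size, splitting off a normalized eigenvector at each step. *)
Lemma orthogonal_diagonalizationP (R : rcfType) n (C : 'M[R]_n) :
  C^T = C -> exists V d, orthogonal_diagonalization C V d.
Proof.
elim: n C => [|n IH] C symC.
  by exists 1%:M, 0; split; apply/matrixP => -[].
have [a /eigenvalueP[v vC v0]] := real_symmetric_eigenvalue symC.
pose x := v^T; have x0 : 0 < (x^T *m x) 0 0.
  by rewrite dot_gt0 // /x trmx_eq0.
pose r := Num.sqrt ((x^T *m x) 0 0).
have r0 : r != 0 by rewrite sqrtr_eq0 -ltNge.
have [||||V [d [hV _ _]]] :=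
  @orthogonal_diagonalization_lift _ _ (r^-1 *: x) a C.
- exact: IH.
- exact: symC.
- rewrite [(_ *: _)^T]linearZ /= -scalemxAl -scalemxAr scalerA.
  rewrite [x^T *m x]mx11_scalar scale_scalar_mx -(sqr_sqrtr (ltW x0)) -/r.
  by rewrite -invfM -expr2 mulVf ?expf_neq0.
- rewrite -scalemxAr scalerA mulrC -scalerA; congr (_ *: _).
  by rewrite /x -[C]trmxK -trmx_mul symC vC linearZ.
by exists V, d.
Qed.

(** * Joint multiplicities and reordering of eigenvalues *)

(** The columns of [V] with eigenvalue pair [(a, b)] are orthonormal and span the joint eigenspace,
    since a joint eigenvector has coordinate zero along every other column. *)
Lemma rank_joint_eigenspace (R : realFieldType) n (C T V : 'M[R]_n)
    (d e : 'rV[R]_n) (a b : R) :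
    orthogonal_diagonalization C V d -> orthogonal_diagonalization T V e ->
  \rank (eigenspace C^T a :&: eigenspace T^T b)%MS =
    #|[pred k | (d 0 k == a) && (e 0 k == b)]|.
Proof.
move=> hC hT; set P := [pred k | _].
pose F : 'M_(#|P|, n) := rowsub (@enum_val _ P) V^T.
have FF : F *m F^T = 1%:M.
  apply/matrixP => i j.
  have /matrixP/(_ (enum_val i) (enum_val j)) := hC.1.
  rewrite !mxE (inj_eq enum_val_inj) => <-.
  by apply: eq_bigr => k _; rewrite !mxE.
have rowF i : row i F = (col (enum_val i) V)^T.
  by apply/rowP => j; rewrite !mxE.
have /eqmx_rank -> : (eigenspace C^T a :&: eigenspace T^T b == F)%MS.
  apply/andP; split; last first.
    apply/row_subP => i; rewrite rowF sub_capmx.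
    have /andP[/eqP <- /eqP <-] := enum_valP i.
    by apply/andP; split; apply/eigenspaceP;
      rewrite -trmx_mul (odiag_col hC, odiag_col hT) linearZ.
  apply/rV_subP => u; rewrite sub_capmx.
  move=> /andP[/eigenspaceP uC /eigenspaceP uT].
  pose y := u *m V.
  have yC k : d 0 k != a -> y 0 k = 0.
    by move=> h; rewrite /y (odiag_eigen_coord hC uC h).
  have yT k : e 0 k != b -> y 0 k = 0.
    by move=> h; rewrite /y (odiag_eigen_coord hT uT h).
  have -> : u = y *m V^T by rewrite -mulmxA (odiag_mulmxtr hC) mulmx1.
  rewrite mulmx_sum_row summx_sub // => k _.
  have [Pk|] := boolP (k \in P); last first.
    by rewrite negb_and => /orP[/yC|/yT] ->; rewrite scale0r sub0mx.
  rewrite scalemx_sub //.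
  have <- : row (enum_rank_in Pk k) F = row k V^T.
    by rewrite rowF enum_rankK_in // tr_col.
  exact: row_sub.
by apply/eqP/row_freeP; exists F^T.
Qed.

Lemma decreasing_perm (R : realFieldType) n (d : 'I_n -> R) :
  exists s : 'S_n, forall i j : 'I_n, (i <= j)%N -> d (s j) <= d (s i).
Proof.
pose r (i j : 'I_n) := d j <= d i.
pose ss := sort r (enum 'I_n).
have tr : transitive r by move=> j i k ji kj; apply: le_trans kj ji.
have tot : total r by move=> i j; apply: le_total.
have szs : size ss = n by rewrite size_sort size_enum_ord.
have ul : uniq ss by rewrite sort_uniq enum_uniq.
(* With ['I_n] possibly empty, the argument [i] itself is the default of [nth]; it is never returned
   by default, as [ss] has length [n]. *)
have inj : injective (fun i : 'I_n => nth i ss i).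
  move=> i j; rewrite (set_nth_default i j) ?szs //.
  by move=> /eqP; rewrite nth_uniq ?szs // => /eqP/val_inj.
exists (perm inj) => i j ij; rewrite !permE /= (set_nth_default i j) ?szs //.
have srt : sorted r ss by apply: sort_sorted.
apply: (sorted_leq_nth tr _ i srt) => //; rewrite ?inE ?szs //.
by move=> k; apply: lexx.
Qed.

Lemma odiag_perm (R : realFieldType) n (C V : 'M[R]_n) (d : 'rV[R]_n) (s : 'S_n) :
  orthogonal_diagonalization C V d ->
  orthogonal_diagonalization C (col_perm s V) (col_perm s d).
Proof.
move=> [VV CV]; split; apply/matrixP => i j.
  have /matrixP/(_ (s i) (s j)) := VV; rewrite !mxE (inj_eq perm_inj) => <-.
  by apply: eq_bigr => k _; rewrite !mxE.
have /matrixP/(_ i (s j)) := CV; rewrite !mul_mx_diag !mxE => <-.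
by apply: eq_bigr => k _; rewrite !mxE.
Qed.

(** * Kronecker products acting on matrices through [vec] *)

Section Vec.
Variables (R : realType) (n : nat).
Implicit Types A B X Y : 'M[R]_n.

Lemma sum_mxtens_index (F : 'I_(n * n) -> R) :
  \sum_k F k = \sum_j \sum_i F (mxtens_index (j, i)).
Proof.
rewrite pair_bigA /= (reindex (@mxtens_index n n)) /=.
  by apply: eq_bigr => -[].
by exists (@mxtens_unindex n n) => k _; rewrite (mxtens_indexK, mxtens_unindexK).
Qed.

Lemma vec_dot X Y : ((vec X)^T *m vec Y) 0 0 = \tr (X^T *m Y).
Proof.
rewrite mxE sum_mxtens_index; apply: eq_bigr => j _; rewrite mxE.
by apply: eq_bigr => i _; rewrite !mxE mxtens_indexK.
Qed.

Lemma tens_vec A B X : (A *t B) *m vec X = vec (B *m X *m A^T).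
Proof.
apply/colP => k; rewrite [LHS]mxE sum_mxtens_index !mxE.
apply: eq_bigr => j _; rewrite mxE big_distrl /=.
by apply: eq_bigr => i _; rewrite !mxE mxtens_indexK /=; ring.
Qed.

Lemma vecD X Y : vec (X + Y) = vec X + vec Y.
Proof. by apply/colP => k; rewrite !mxE. Qed.

Lemma vecN X : vec (- X) = - vec X.
Proof. by apply/colP => k; rewrite !mxE. Qed.

Lemma vecZ a X : vec (a *: X) = a *: vec X.
Proof. by apply/colP => k; rewrite !mxE. Qed.

Lemma vec_eq0 X : (vec X == 0) = (X == 0).
Proof.
apply/eqP/eqP => [X0|->]; last by apply/colP => k; rewrite !mxE.
apply/matrixP => i j; have /colP/(_ (mxtens_index (j, i))) := X0.
by rewrite !mxE mxtens_indexK.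
Qed.

Lemma kron_sym_vec A B X :
  kron_sym A B *m vec X = vec (B *m X *m A^T + A *m X *m B^T).
Proof. by rewrite mulmxDl !tens_vec vecD. Qed.

Lemma kron_sym_tr A B :
  A^T = A /\ B^T = B \/ A^T = - A /\ B^T = - B ->
  (kron_sym A B)^T = kron_sym A B.
Proof.
rewrite /kron_sym [(_ + _)^T]raddfD /= !trmx_tens => -[] [-> ->] //.
by congr (_ + _); apply/matrixP => i j; rewrite !mxE mulrNN.
Qed.

(** For [x = vec X] with $X^\top = \pm X$, the forms of [A *t B] and [B *t A] agree: up to a common
    sign they are [\tr (X *m B *m X *m A)] and [\tr (X *m A *m X *m B)], equal by cyclicity of the
    trace. *)
Lemma form_kron_sym A B (x : 'cV[R]_(n * n)) :
    A^T = A /\ B^T = B \/ A^T = - A /\ B^T = - B ->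
    symmetric_vec x \/ Defs.skew_vec x ->
  (x^T *m kron_sym A B *m x) 0 0 = 2 * (x^T *m (A *t B) *m x) 0 0.
Proof.
have [X <-] := vec_surj x.
rewrite /symmetric_vec /Defs.skew_vec commutation_mxP => hAB hX.
rewrite -!mulmxA kron_sym_vec tens_vec !vec_dot mulmxDr mxtraceD.
rewrite mulr2n mulrDl mul1r.
congr (_ + _).
have key P Q : \tr (X *m (P *m X *m Q)) = \tr (X *m (Q *m X *m P)).
  by rewrite !mulmxA -mulmxA mxtrace_mulC !mulmxA.
have {}hX : X^T = X \/ X^T = - X.
  case: hX => [/eqP|/eqP]; rewrite -subr_eq0 ?opprK -?vecN -vecD vec_eq0.
    by rewrite subr_eq0 => /eqP; left.
  by rewrite addr_eq0 => /eqP; right.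
by case: hAB => -[-> ->]; case: hX => ->;
  rewrite ?(mulNmx, mulmxN, raddfN) /= key.
Qed.

End Vec.

(** * Two-by-two matrices: the line of odd vectors and an even competitor *)

Section Dim2.
Variable R : realType.
Implicit Types A B X Y : 'M[R]_2.

Lemma sum2E (V : nmodType) (F : 'I_2 -> V) : \sum_i F i = F 0 + F 1.
Proof. by rewrite big_ord_recl big_ord1; congr (_ + F _); apply: val_inj. Qed.

Lemma matrix2P X Y :
  X 0 0 = Y 0 0 -> X 0 1 = Y 0 1 -> X 1 0 = Y 1 0 -> X 1 1 = Y 1 1 -> X = Y.
Proof.
have E (i : 'I_2) : i = 0 \/ i = 1.
  by case: i => -[|[|//]] ?; [left | right]; apply: val_inj.
by move=> *; apply/matrixP => i j; case: (E i) => ->; case: (E j) => ->.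
Qed.

Definition J2 : 'M[R]_2 := \matrix_(i, j) ((j : nat)%:R - (i : nat)%:R).

Lemma J2E : (J2 0 0 = 0) * (J2 0 1 = 1) * (J2 1 0 = -1) * (J2 1 1 = 0).
Proof. by rewrite !mxE !subrr subr0 sub0r. Qed.

(** The factor normalizes [J2], whose Frobenius norm is $\sqrt 2$. *)
Definition skew_unit : 'cV[R]_(2 * 2) := vec ((Num.sqrt 2)^-1 *: J2).

Lemma double_sqr_sqrt2V : 2 * ((Num.sqrt 2)^-1 * (Num.sqrt 2)^-1) = 1 :> R.
Proof. by rewrite -invfM -expr2 sqr_sqrtr // mulfV ?pnatr_eq0. Qed.

Lemma skew_unit_dot X :
  (skew_unit^T *m vec X) 0 0 = (Num.sqrt 2)^-1 * (X 0 1 - X 1 0).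
Proof.
by rewrite vec_dot /mxtrace !(sum2E, J2E, mxE); ring.
Qed.

Lemma skew_unit_norm : skew_unit^T *m skew_unit = 1%:M.
Proof.
rewrite [LHS]mx11_scalar skew_unit_dot !(J2E, mxE); congr _%:M.
by ring: double_sqr_sqrt2V.
Qed.

(** Transposition subtracts [(X 0 1 - X 1 0) *: J2], twice the skew part of [X]; it is thus the
    reflection in the hyperplane orthogonal to [skew_unit]. *)
Lemma commutation_mx2E :
  commutation_mx R 2 = 1%:M - 2 *: (skew_unit *m skew_unit^T).
Proof.
symmetry; apply: commutation_mx_unique => X.
rewrite mulmxBl mul1mx -scalemxAl -mulmxA [_^T *m _]mx11_scalar skew_unit_dot.
rewrite mul_mx_scalar -!vecZ -vecN -vecD !scalerA; congr vec.
have -> : 2 * ((Num.sqrt 2)^-1 * (X 0 1 - X 1 0)) * (Num.sqrt 2)^-1 =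
    X 0 1 - X 1 0.
  transitivity
    (2 * ((Num.sqrt 2)^-1 * (Num.sqrt 2)^-1) * (X 0 1 - X 1 0)); first by ring.
  by rewrite double_sqr_sqrt2V mul1r.
by apply: matrix2P; rewrite !(J2E, mxE); ring.
Qed.

(** This polarizes $A J A^\top = \det(A)\, J$; the coefficient is $\det(A+B)-\det A-\det B$. *)
Lemma kron_sym_skew_unit A B :
  kron_sym A B *m skew_unit =
  (A 0 0 * B 1 1 + A 1 1 * B 0 0 - A 0 1 * B 1 0 - A 1 0 * B 0 1) *: skew_unit.
Proof.
rewrite kron_sym_vec -vecZ; congr vec.
by apply: matrix2P; rewrite !(sum2E, J2E, mxE); ring.
Qed.

(** The coefficient is [\tr (B *m \adj A)]. The chosen symmetric [X] satisfies $X^2 = c I$ and $X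
    A^\top X = c\,\mathrm{adj}(A)$ for some scalar $c$, so both sides equal $2c$ times that
    trace. *)
Lemma exists_symmetric_form A B :
    A^T = A /\ B^T = B \/ A^T = - A /\ B^T = - B ->
  exists X, [/\ X^T = X, X != 0 &
    \tr (X^T *m (B *m X *m A^T)) * 2 =
    (A 0 0 * B 1 1 + A 1 1 * B 0 0 - A 0 1 * B 1 0 - A 1 0 * B 0 1)
       * \tr (X^T *m X)].
Proof.
move=> hAB.
have [AJ|AJ] := eqVneq (A *m J2 - J2 *m A) 0.
  (* Commuting with [J2] forces [A 0 0 = A 1 1] and [A 1 0 = - A 0 1], that is [A^T = \adj A]. *)
  exists 1%:M; split; [exact: trmx1 | by rewrite -mxrank_eq0 mxrank1 |].
  have /eqP : A 0 0 - A 1 1 = 0.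
    have /matrixP/(_ 0 1) := AJ.
    by rewrite !(sum2E, J2E, mxE) => e; apply: etrans e; ring.
  have /eqP : A 1 0 + A 0 1 = 0.
    have /matrixP/(_ 0 0)/(congr1 -%R) := AJ.
    by rewrite !(sum2E, J2E, mxE) oppr0 => e; apply: etrans e; ring.
  rewrite trmx1 !mul1mx mulmx1 mxtrace1 subr_eq0 addr_eq0 /mxtrace.
  by rewrite !(sum2E, J2E, mxE) => /eqP-> /eqP->; ring.
(* A skew-symmetric [A] has zero diagonal, so it is a multiple of [J2] and commutes with it,
   contrary to [AJ]. *)
case: hAB => -[/matrixP eA /matrixP eB]; last first.
  move: (eA 0 0) (eA 0 1) (eA 1 1); rewrite !mxE => A00 A01 A11.
  have /eqP : - A 0 0 == A 0 0 by rewrite -A00.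
  have /eqP : - A 1 1 == A 1 1 by rewrite -A11.
  move=> /eqP; rewrite eqNr => /eqP e11 /eqP; rewrite eqNr => /eqP e00.
  case/eqP: AJ; apply: matrix2P; rewrite !(sum2E, J2E, mxE) ?A01 ?e00 ?e11; ring.
move: (eA 0 1) (eB 0 1); rewrite !mxE => eA01 eB01.
exists (A *m J2 - J2 *m A); split=> //.
  by apply: matrix2P; rewrite !(sum2E, J2E, mxE) eA01; ring.
by rewrite /mxtrace !(sum2E, J2E, mxE) eA01 eB01; ring.
Qed.

End Dim2.

(** * Sorted lists and Rayleigh quotients *)

Lemma nth_sorted_ge (R : realDomainType) (s : seq R) x :
  sorted >=%R s -> x \in s -> s`_(size s).-1 <= x <= s`_0.
Proof.
move=> srt xs; have tr : transitive (>=%R : rel R) by apply: ge_trans.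
have hx : (index x s < size s)%N by rewrite index_mem.
have s0 : (0 < size s)%N by apply: leq_ltn_trans hx.
rewrite -(nth_index 0 xs); apply/andP; split.
  apply: (sorted_leq_nth tr (@lexx _ _)); rewrite ?inE ?prednK //.
  by rewrite -ltnS prednK.
by apply: (sorted_leq_nth tr (@lexx _ _)).
Qed.

Lemma rayleigh_kron (R : realType) n (A B : 'M[R]_n) (x : 'cV[R]_(n * n)) :
    A^T = A /\ B^T = B \/ A^T = - A /\ B^T = - B ->
    symmetric_vec x \/ Defs.skew_vec x ->
  rayleigh (A *t B) x = (x^T *m kron_sym A B *m x) 0 0 / (x^T *m x) 0 0 / 2.
Proof.
move=> hAB hx; rewrite form_kron_sym // /rayleigh mulrAC.
by rewrite [2 * _]mulrC mulfK ?pnatr_eq0.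
Qed.

Lemma rayleigh_eigenvector (R : realType) n (A B : 'M[R]_n) a
    (x : 'cV[R]_(n * n)) :
    A^T = A /\ B^T = B \/ A^T = - A /\ B^T = - B ->
    symmetric_vec x \/ Defs.skew_vec x -> x != 0 ->
  kron_sym A B *m x = a *: x -> rayleigh (A *t B) x = a / 2.
Proof.
move=> hAB hx x0 Cx; rewrite rayleigh_kron // -mulmxA Cx -scalemxAr mxE mulfK //.
by rewrite gt_eqF // dot_gt0.
Qed.

(** * The three interlacing properties in dimension two *)

(** The order fits a basis whose column 0 is the odd vector [skew_unit], followed by three even
    vectors. *)
Definition commutation_eigenvalues (R : realType) : 'rV[R]_4 :=
  \row_k if k == 0 then -1 else 1.

Section Main.
Variables (R : realType) (A B : 'M[R]_2).
Hypothesis hAB : A^T = A /\ B^T = B \/ A^T = - A /\ B^T = - B.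
Local Notation C := (kron_sym A B).
Local Notation T := (commutation_mx R 2).
Local Notation w := (skew_unit R).
Local Notation e := (commutation_eigenvalues R).

(* [T = 1 - 2 w w^T], so the columns orthogonal to [w] are symmetric vectors. *)
Lemma kron_diagonalization : exists (V : 'M[R]_4) (d : 'rV[R]_4),
  [/\ orthogonal_diagonalization C V d, orthogonal_diagonalization T V e &
      C *m w = d 0 0 *: w].
Proof.
have Cw := kron_sym_skew_unit A B.
have [V [d [hV V0 d0]]] := orthogonal_diagonalization_lift
  (@orthogonal_diagonalizationP R 3) (kron_sym_tr hAB)
  (skew_unit_norm R) Cw.
exists V, d; split; [exact: hV | | by rewrite d0].
split; first exact: hV.1.
rewrite commutation_mx2E mulmxBl mul1mx -scalemxAl -mulmxA -V0.
(* Since [w] is column 0 of the orthogonal [V], only that column changes sign under [T]. *)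
have -> : (col 0 V)^T *m V = row 0 1%:M by rewrite tr_col -row_mul hV.1.
apply/matrixP => i j; rewrite mul_mx_diag !mxE big_ord1 !mxE /=.
by case: (eqVneq j 0) => [->|_]; rewrite /=; ring.
Qed.

Variables (V : 'M[R]_4) (d : 'rV[R]_4).
Hypotheses (hC : orthogonal_diagonalization C V d)
  (hT : orthogonal_diagonalization T V e) (Cw : C *m w = d 0 0 *: w).

Lemma col_sym (k : 'I_4) : k != 0 -> symmetric_vec (col k V : 'cV_(2 * 2)).
Proof.
by move=> k0; rewrite /symmetric_vec (odiag_col hT) mxE (negPf k0) scale1r.
Qed.

Lemma col_skew : Defs.skew_vec (col 0 V : 'cV_(2 * 2)).
Proof. by rewrite /Defs.skew_vec (odiag_col hT) mxE scaleN1r. Qed.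

Lemma col_neq0 k : col k V != 0.
Proof.
apply/eqP => V0; have /matrixP/(_ k k) := hC.1.
rewrite mxE [RHS]mxE eqxx big1 => [/eqP|i _]; first by rewrite eq_sym oner_eq0.
by have /colP/(_ i) := V0; rewrite !mxE => ->; rewrite mulr0.
Qed.

(** By the reflection formula, [T x = - x] says that [x] is its own projection on the line of
    [w]. *)
Lemma skew_eigen (x : 'cV[R]_(2 * 2)) : Defs.skew_vec x -> C *m x = d 0 0 *: x.
Proof.
rewrite /Defs.skew_vec commutation_mx2E mulmxBl mul1mx -scalemxAl -mulmxA.
rewrite [_^T *m _]mx11_scalar mul_mx_scalar => Tx.
have [c ->] : exists c, x = c *: w.
  exists ((w^T *m x) 0 0); apply: (@scalerI _ _ 2); rewrite ?pnatr_eq0 //.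
  by rewrite scaler_nat mulr2n -{2}[x]opprK -Tx opprB addrC subrK.
by rewrite -scalemxAr Cw !scalerA mulrC.
Qed.

(** The even eigenvalues: [lift ord0] skips the odd column 0. *)
Let D (i : 'I_3) := d 0 (lift ord0 i).

(** The coordinates are those in the basis [V]; the one along column 0 vanishes because [T] has
    eigenvalue -1 there and 1 on [u]. *)
Lemma sym_form (u : 'cV[R]_(2 * 2)) : symmetric_vec u ->
  exists z : 'I_3 -> R, (u^T *m u) 0 0 = \sum_i z i ^+ 2 /\
    (u^T *m C *m u) 0 0 = \sum_i D i * z i ^+ 2.
Proof.
move=> Tu; pose z (k : 'I_4) := (V^T *m u) k 0.
exists (fun i => z (lift ord0 i)).
have z0 : z 0 = 0.
  have e01 : e 0 0 != 1.
    by rewrite mxE eqxx eq_sym -subr_eq0 opprK -mulr2n pnatr_eq0.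
  have uT : u^T *m T^T = 1 *: u^T by rewrite -trmx_mul Tu scale1r.
  rewrite -(odiag_eigen_coord hT uT e01) /z.
  by rewrite -[V^T *m u]trmxK trmx_mul trmxK mxE.
rewrite (odiag_dot hC) (odiag_form hC) !big_ord_recl -/(z _) z0.
by rewrite expr0n mulr0 !add0r.
Qed.

Lemma sym_form_le (u : 'cV[R]_(2 * 2)) m : symmetric_vec u ->
  (forall i, D i <= m) -> (u^T *m C *m u) 0 0 <= m * (u^T *m u) 0 0.
Proof.
move=> /sym_form[z [-> ->]] Dm; rewrite mulr_sumr.
by apply: ler_sum => i _; rewrite ler_wpM2r ?sqr_ge0.
Qed.

Lemma sym_form_ge (u : 'cV[R]_(2 * 2)) m : symmetric_vec u ->
  (forall i, m <= D i) -> m * (u^T *m u) 0 0 <= (u^T *m C *m u) 0 0.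
Proof.
move=> /sym_form[z [-> ->]] Dm; rewrite mulr_sumr.
by apply: ler_sum => i _; rewrite ler_wpM2r ?sqr_ge0.
Qed.

Lemma odd_form_attained : exists u : 'cV[R]_(2 * 2),
  [/\ symmetric_vec u, u != 0 &
    (u^T *m C *m u) 0 0 = d 0 0 * (u^T *m u) 0 0].
Proof.
have [X [sX X0 eX]] := exists_symmetric_form hAB.
have Tu : symmetric_vec (vec X) by rewrite /symmetric_vec commutation_mxP sX.
exists (vec X); split; rewrite ?vec_eq0 //.
rewrite form_kron_sym; [|exact: hAB|by left].
rewrite -mulmxA tens_vec !vec_dot mulrC eX; congr (_ * _).
(* The explicit coefficient and [d 0 0] are eigenvalues of [C] at the same nonzero vector, hence
   equal. *)
have w0 : w != 0.
  apply/eqP => w0; have := skew_unit_norm R.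
  by rewrite w0 mulmx0 => /matrixP/(_ 0 0)/eqP; rewrite !mxE eq_sym oner_eq0.
have /eqP := kron_sym_skew_unit A B; rewrite Cw -subr_eq0 -scalerBl scaler_eq0.
by rewrite (negPf w0) orbF subr_eq0 => /eqP.
Qed.

(** The odd eigenvalue is a Rayleigh quotient of [C] at an even vector, and such quotients are
    weighted means of the even eigenvalues. *)
Lemma extremal_even_eigenvalues : exists imin imax : 'I_3,
  [/\ forall i, D imin <= D i, forall i, D i <= D imax,
    D imin <= d 0 0 & d 0 0 <= D imax].
Proof.
have [imin _ hmin] := Order.TotalTheory.arg_minP D (erefl : xpredT (0 : 'I_3)).
have [imax _ hmax] := Order.TotalTheory.arg_maxP D (erefl : xpredT (0 : 'I_3)).
have [u [Tu u0 eu]] := odd_form_attained.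
have uu := dot_gt0 u0.
exists imin, imax; split=> [i|i||]; [exact: hmin|exact: hmax| |].
  rewrite -(ler_pM2r uu) -eu; apply: sym_form_ge => // i; exact: hmin.
rewrite -(ler_pM2r uu) -eu; apply: sym_form_le => // i; exact: hmax.
Qed.

(** On odd vectors the quotient is constant; on even ones its extremes are attained at columns of
    [V]. Eigenvalues are halved because [A *t B] has half the form of [C] on these vectors. *)
Lemma weak_interlacing2 : weak_interlacing A B.
Proof.
have [imin [imax [hmin hmax mind maxd]]] := extremal_even_eigenvalues.
have lift0 (i : 'I_3) : lift ord0 i != 0 :> 'I_4 by [].
have eig i : rayleigh (A *t B) (col (lift ord0 i) V) = D i / 2.
  apply: rayleigh_eigenvector => //; [|exact: col_neq0|exact: (odiag_col hC)].
  by left; apply: col_sym.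
have ray_sym i : sym_rayleigh (A *t B) (D i / 2).
  exists (col (lift ord0 i) V) => //; split; [exact: col_sym|exact: col_neq0].
have ray_skew : skew_rayleigh (A *t B) (d 0 0 / 2).
  exists (col 0 V); first by split; [exact: col_skew|exact: col_neq0].
  apply: rayleigh_eigenvector => //; [|exact: col_neq0|exact: (odiag_col hC)].
  by right; apply: col_skew.
have skewE r : skew_rayleigh (A *t B) r -> r = d 0 0 / 2.
  move=> [x [Tx x0] <-]; apply: rayleigh_eigenvector => //; first by right.
  exact: skew_eigen.
exists (D imin / 2), (d 0 0 / 2), (D imax / 2), (d 0 0 / 2); split; last first.
  by rewrite !ler_pM2r ?invr_gt0.
split; split=> //.
- move=> _ [u [Tu u0] <-]; rewrite rayleigh_kron //; last by left.
  rewrite ler_pM2r ?invr_gt0 // ler_pdivlMr ?dot_gt0 //.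
  exact: sym_form_ge.
- by move=> r /skewE->.
- move=> _ [u [Tu u0] <-]; rewrite rayleigh_kron //; last by left.
  rewrite ler_pM2r ?invr_gt0 // ler_pdivrMr ?dot_gt0 //.
  exact: sym_form_le.
- by move=> r /skewE->.
Qed.

(** The basis shared by [C] and [T] sorts the entries of [d] by parity: [d 0 0] is odd and the
    values of [D] are even. *)
Lemma interlacing2 : interlacing A B.
Proof.
have [imin [imax [_ _ mind maxd]]] := extremal_even_eigenvalues.
pose l := sort >=%R [seq D i | i <- enum 'I_3].
have sl : size l = 3%N by rewrite size_sort size_map size_enum_ord.
have srt : sorted >=%R l by apply: sort_sorted; apply: ge_total.
have Dl i : D i \in l by rewrite mem_sort map_f ?mem_enum.
have e0 : e 0 ord0 = -1 by rewrite mxE.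
have eS i : e 0 (lift ord0 i) = 1 by rewrite mxE.
have N11 : (-1 == 1 :> R) = false.
  by rewrite eq_sym -subr_eq0 opprK -mulr2n pnatr_eq0.
have pl : size l == ((2 * 3) %/ 2)%N by rewrite sl.
have pb : size [:: d 0 0] == ((2 * 1) %/ 2)%N by [].
exists (Tuple pl), (Tuple pb); split.
- split=> // a; rewrite /even_mult (rank_joint_eigenspace _ _ hC hT).
  rewrite /= count_sort count_map -sum1_count big_enum_cond /=.
  rewrite -sum1_card big_mkcond [RHS]big_mkcond /= [RHS]big_ord_recl.
  (* The odd column 0 drops out of the count because -1 differs from 1. *)
  rewrite inE e0 [X in _ && X]N11 andbF add0n; apply: eq_bigr => i _.
  by rewrite inE eS eqxx andbT.
- split=> // a; rewrite /odd_mult (rank_joint_eigenspace _ _ hC hT).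
  rewrite -sum1_card [RHS]big_mkcond /= [RHS]big_ord_recl big1.
    by rewrite inE e0 eqxx andbT; case: eqP.
  by move=> i _; rewrite inE eS [X in _ && X]eq_sym [X in _ && X]N11 andbF.
(* Here [s = 3] and [t = 1]: only index 0 occurs, and [s - t + 0 = 2] is the last position of
   [l]. *)
move=> [|//] _ /=; split.
  by have /andP[_] := nth_sorted_ge srt (Dl imax); apply: le_trans.
by have /andP[+ _] := nth_sorted_ge srt (Dl imin); rewrite sl => /le_trans; apply.
Qed.

(** Once the columns are sorted by eigenvalue, exactly one is odd, so its neighbours are even. *)
Lemma strong_interlacing2 : strong_interlacing A B.
Proof.
have [s hs] := decreasing_perm (fun k => d 0 k).
have hCs := odiag_perm s hC.
have colE k : col k (col_perm s V) = col (s k) V.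
  by apply/colP => i; rewrite !mxE.
(* Any column other than column 0 is symmetric; were it also skew, it would equal its opposite and
   vanish. *)
have skewP k : Defs.skew_vec (col (s k) V : 'cV_(2 * 2)) -> s k = 0.
  move=> skw; apply/eqP; apply: contraTT isT => /col_sym sym.
  have /eqP := col_neq0 (s k); case.
  have : col (s k) V = - col (s k) V by rewrite -[RHS]skw sym.
  move=> /eqP; rewrite -subr_eq0 opprK -mulr2n -scaler_nat scaler_eq0.
  by rewrite pnatr_eq0 => /eqP.
exists (fun k => d 0 (s k)), (col_perm s V); split.
- exact: hs.
- exact: hCs.1.
- by move=> k; rewrite (odiag_col hCs) mxE.
- move=> k; rewrite colE; have [->|/col_sym] := eqVneq (s k) 0; last by left.
  by right; apply: col_skew.
(* The permutation [s] is injective, so positions adjacent to [k] are not sent to 0. *)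
move=> i k j ki jk; rewrite !colE => /skewP sk0.
by split; apply: col_sym; rewrite -sk0 (inj_eq perm_inj) -val_eqE /= ?jk ?ki;
  rewrite ?neq_ltn ?ltnSn ?orbT.
Qed.

End Main.

Theorem corollary5 (R : realType) (A B : 'M[R]_2)
    (hAB : (A^T = A /\ B^T = B) \/ (A^T = - A /\ B^T = - B)) :
  [/\ weak_interlacing A B, interlacing A B & strong_interlacing A B].
Proof.
have [V [d [hC hT Cw]]] := kron_diagonalization hAB.
split.
- exact: weak_interlacing2 hC hT Cw.
- exact: interlacing2 hC hT Cw.
- exact: strong_interlacing2 hC hT.
Qed.
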